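(* Let $Y$ be a random variable whose moment generating function $E[e^{tY}]$ exists for $|t|<r_0$ for some $r_0>0$. Let $(Y_j)_{j\ge1}$ be mutually independent copies of $Y$, $S_0=0$, $S_k=Y_1+\cdots+Y_k$ for $k\ge1$. Let $r$ be a positive integer and let $$\phi_{n,r}^Y(x)=\sum_{k=0}^{n}{n+r\brace k+r}_{r,Y}x^k,\qquad {n+r\brace k+r}_{r,Y}=\frac{1}{k!}\sum_{j=0}^{k}\binom{k}{j}(-1)^{k-j}E\big[(S_j+r)^n\big].$$ Then for all integers $m,n\ge0$, $$\phi_{m+n,r}^Y(x)=\sum_{i=0}^{n}\sum_{k=0}^{m}\binom{n}{i}\phi_{i,r}^Y(x)x^k\frac{1}{k!}\sum_{j=k}^{m}\binom{m}{j}\sum_{l_1+\cdots+l_k=j}\binom{j}{l_1,\dots,l_k}r^{m-j}E\Big[S_k^{n-i}\prod_{p=1}^{k}Y_p^{l_p}\Big],$$ where the innermost sum runs over $k$-tuples $(l_1,\dots,l_k)$ of positive integers with sum $j$.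
   Context: $\phi_{n,r}^Y(x)$ are the probabilistic $r$-Bell polynomials associated with $Y$. For $k=0$ the sum over $(l_1,\dots,l_k)$ equals $1$ if $j=0$ and $0$ otherwise (empty product equal to $1$). $\binom{j}{l_1,\dots,l_k}$ is the multinomial coefficient. *)

(* Defs.v *)
From HB Require Import structures.
From mathcomp Require Import all_boot all_order all_algebra.
From mathcomp Require Import all_classical all_reals all_analysis.
Set Implicit Arguments. Unset Strict Implicit. Unset Printing Implicit Defensive.
Import Order.TTheory GRing.Theory Num.Theory.
Local Open Scope classical_set_scope.
Local Open Scope ring_scope.

Section Defs.
Context {d : measure_display} {T : measurableType d} {R : realType}.
Variable P : probability T R.

(* real-valued expectation E[f] (all expectations used below are finite
   thanks to the moment generating function hypothesis) *)
Definition Ex (f : T -> R) : R := Rintegral P setT f.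

Definition mutually_independent (X : nat -> T -> R) : Prop :=
  forall (J : seq nat) (B : nat -> set R),
    uniq J -> (forall j, measurable (B j)) ->
    P (\bigcap_(j in [set` J]) (X j @^-1` B j)) =
    (\prod_(j <- J) P (X j @^-1` B j))%E.

Definition same_law (X Y : T -> R) : Prop :=
  forall B : set R, measurable B -> P (X @^-1` B) = P (Y @^-1` B).

Definition mgf_exists_near0 (Y : T -> R) (r0 : R) : Prop :=
  forall t : R, `|t| < r0 -> P.-integrable setT (fun x => (expR (t * Y x))%:E).

(* partial sums S_k = Y_1 + ... + Y_k  (Y_p is Ys (p-1)) *)
Definition Ssum (Ys : nat -> T -> R) (k : nat) : T -> R :=
  fun x => \sum_(i < k) Ys i x.

Definition rStirY (Ys : nat -> T -> R) (r n k : nat) : R :=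
  (k`!%:R)^-1 * \sum_(j < k.+1)
     ('C(k, j)%:R * (-1) ^+ (k - j) * Ex (fun x => (Ssum Ys j x + r%:R) ^+ n)).

Definition rBellY (Ys : nat -> T -> R) (r n : nat) (x : R) : R :=
  \sum_(k < n.+1) rStirY Ys r n k * x ^+ k.

End Defs.

Definition multinom {R : realType} (j k : nat) (l : 'I_k -> nat) : R :=
  j`!%:R / (\prod_(p < k) (l p)`!)%:R.

(* Main.v *)
Require Import Defs.
From HB Require Import structures.
From mathcomp Require Import all_boot all_order all_algebra.
From mathcomp Require Import all_classical all_reals all_analysis.
From mathcomp Require Import measurable_realfun ring.
Import Order.TTheory GRing.Theory Num.Theory.
Local Open Scope classical_set_scope.
Local Open Scope ring_scope.

(* Write [M] for the moment generating function of [Y].  In exponential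
   generating functions, [E (S_j + r)^(m + n)] is [m! n!] times the coefficient
   of [u^m t^n] in [e^(r(u + t)) M(u + t)^j].  Splitting
   [M(u + t) = M(t) + D(u, t)] with [D = E (e^(tY) (e^(uY) - 1))], the binomial
   theorem gives
     [E (S_j + r)^(m + n) =
        sum_k sum_i C(n, i) c(m, k, n - i) C(j, k) E (S_(j - k) + r)^i],
   where [c(m, k, q) / (m! q!)] is the coefficient of [u^m t^q] in
   [e^(ru) D^k], that is, the sum over [(l_1, ..., l_k)] of the theorem.  The
   [K]-th difference at [0] of [j |-> C(j, k) a(j - k)] is [C(K, k)] times the
   [(K - k)]-th difference of [a], which turns this identity into the one
   between Bell polynomials.  All generating functions are truncated to
   polynomials of large degree. *)

(** * Finite differences *)

Lemma big_ord_trunc (V : nmodType) (F : nat -> V) a b : (a <= b)%N ->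
  (forall k, (a <= k)%N -> F k = 0) -> \sum_(k < b) F k = \sum_(k < a) F k.
Proof.
move=> ab F0; rewrite -!(big_mkord xpredT) (@big_cat_nat _ _ _ a)//=.
by rewrite [X in _ + X]big_nat [X in _ + X]big1 ?addr0// => k /andP[/F0].
Qed.

Section BinomialTransform.
Context {R : numFieldType}.
Implicit Types (a : nat -> R) (k K : nat).

(** The [K]-th forward difference of [a] at [0]. With [a j] the expectation of [(S_j + r)^n], it is
    [K!] times the [r]-Stirling number in [rStirY]. *)
Definition fdiff a K : R := \sum_(j < K.+1) 'C(K, j)%:R * (-1) ^+ (K - j) * a j.

(** The sum is the binomial expansion of [(-1 + 1)^K]. *)
Lemma fdiff_const1 K : fdiff (fun=> 1) K = (K == 0%N)%:R.
Proof.
rewrite /fdiff -[RHS](expr0n R K) -[in RHS](addNr (1 : R)) exprDn.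
by apply: eq_bigr => j _; rewrite expr1n !mulr1 mulr_natl.
Qed.

(** The terms with [j < k] vanish, and the others are reindexed by [j + k] and rewritten with [C(K,
    k + j) C(k + j, k) = C(K, k) C(K - k, j)]. *)
Lemma fdiff_bin_shift a k K :
  fdiff (fun j => 'C(j, k)%:R * a (j - k)%N) K = 'C(K, k)%:R * fdiff a (K - k).
Proof.
rewrite /fdiff; have [Kk|kK] := ltnP K k.
  rewrite [in RHS]bin_small// mul0r big1// => j _.
  by rewrite [X in _ * (X%:R * _)]bin_small ?mul0r ?mulr0// (leq_ltn_trans _ Kk)// -ltnS.
rewrite -(big_mkord xpredT
  (fun j => 'C(K, j)%:R * (-1) ^+ (K - j) * ('C(j, k)%:R * a (j - k)%N))).
rewrite (@big_cat_nat _ _ _ k)//= ?leqW// big_nat big1 ?add0r; last first.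
  by move=> j /andP[_ jk]; rewrite [X in _ * (X%:R * _)]bin_small// mul0r mulr0.
rewrite -{1}[k]add0n big_addn subSn// big_mkord mulr_sumr.
apply: eq_bigr => j _; rewrite addnK -subnDA addnC.
have jK : (j <= K - k)%N by rewrite -ltnS.
have : ('C(K, k + j) * 'C(k + j, k) = 'C(K, k) * 'C(K - k, j))%N.
  have jkK : (k + j <= K)%N by rewrite -leq_subRL.
  (* After multiplication by [k! j! (K - (k + j))!] both sides equal [K!]. *)
  apply/eqP; rewrite -(@eqn_pmul2r (k`! * j`! * (K - (k + j))`!)) ?muln_gt0 ?fact_gt0//.
  have E1 := bin_fact jkK; have E2 := bin_fact (leq_addr j k).
  have E3 := bin_fact kK; have E4 := bin_fact jK.
  rewrite addKn in E2; rewrite -subnDA in E4; apply/eqP.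
  transitivity K`!.
    by rewrite -[RHS]E1 -E2 !mulnA; congr (_ * _)%N; rewrite -!mulnA; congr (_ * _)%N.
  by rewrite -[LHS]E3 -E4 -!mulnA; congr (_ * _)%N; rewrite !mulnA; congr (_ * _)%N;
    rewrite -!mulnA mulnCA.
move=> /(congr1 (fun i => i%:R : R)); rewrite !natrM => E.
by rewrite mulrACA E -!mulrA.
Qed.

(* The case [n = 0] of the hypothesis on [s (m + n)] shows that the differences
   at [0] of [s i] of order larger than [i] vanish. *)
Lemma bell_addition (x : R) (s : nat -> nat -> R) (c : nat -> nat -> nat -> R) m n :
  (forall j, s 0%N j = 1) ->
  (forall m n j, s (m + n)%N j =
    \sum_(k < m.+1) \sum_(i < n.+1)
      'C(n, i)%:R * c m k (n - i)%N * ('C(j, k)%:R * s i (j - k)%N)) ->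
  let phi n := \sum_(k < n.+1) (k`!%:R)^-1 * fdiff (s n) k * x ^+ k in
  phi (m + n)%N = \sum_(i < n.+1) \sum_(k < m.+1)
    'C(n, i)%:R * phi i * x ^+ k * (k`!%:R)^-1 * c m k (n - i)%N.
Proof.
move=> s0 sD phi.
have fdiff_s m' n' K : fdiff (s (m' + n')%N) K = \sum_(k < m'.+1) \sum_(i < n'.+1)
    'C(n', i)%:R * c m' k (n' - i)%N * ('C(K, k)%:R * fdiff (s i) (K - k)).
  under eq_bigr => k _ do under eq_bigr => i _ do rewrite -fdiff_bin_shift mulr_sumr.
  under eq_bigr do rewrite exchange_big/=.
  rewrite exchange_big/=; apply: eq_bigr => j _; rewrite sD mulr_sumr.
  apply: eq_bigr => k _; rewrite mulr_sumr; apply: eq_bigr => i _.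
  by rewrite mulrCA.
have fdiff_s_eq0 i K : (i < K)%N -> fdiff (s i) K = 0.
  move=> iK; rewrite -[i]addn0 fdiff_s big1// => k _.
  rewrite big_ord1 (_ : s _ = fun=> 1); last exact/funext.
  rewrite fdiff_const1 subn_eq0 leqNgt (leq_trans _ iK) ?mulr0//.
(* Since the higher differences vanish, the sum defining [phi i] may run to any bound [N >= i]. *)
have phi_widen i N : (i <= N)%N ->
    phi i = \sum_(0 <= k < N.+1) (k`!%:R)^-1 * fdiff (s i) k * x ^+ k.
  move=> iN; rewrite (@big_cat_nat _ _ _ i.+1)//= [X in _ + X]big_nat.
  rewrite [X in _ + X]big1 ?addr0 ?big_mkord// => k /andP[ik _].
  by rewrite fdiff_s_eq0// mulr0 mul0r.
(* The substitution of [K + k] for [K] and [C(K + k, k) / (K + k)! = 1 / (k! K!)] factor out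
   [x^k / k!]. The remaining sum runs to [m + n - k], which is at least [i]. *)
have shift i k : (i <= n)%N -> (k <= m)%N ->
    \sum_(K < (m + n).+1) (K`!%:R)^-1 * ('C(K, k)%:R * fdiff (s i) (K - k)) * x ^+ K =
    phi i * x ^+ k * (k`!%:R)^-1.
  move=> ik km.
  have km' : (k <= m + n)%N by rewrite (leq_trans km)// leq_addr.
  rewrite -(big_mkord xpredT
    (fun K => (K`!%:R)^-1 * ('C(K, k)%:R * fdiff (s i) (K - k)) * x ^+ K)).
  rewrite (@big_cat_nat _ _ _ k)//= ?leqW// big_nat big1 ?add0r; last first.
    by move=> K /andP[_ Kk]; rewrite bin_small// mul0r mulr0 mul0r.
  rewrite (phi_widen i (m + n - k)%N); last first.
    by rewrite leq_subRL// leq_add.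
  rewrite -{1}[k]add0n big_addn subSn// -mulrA mulr_suml.
  apply: eq_bigr => K _; rewrite addnK exprD.
  have : ('C(K + k, k)%:R * (k`!%:R * K`!%:R) = (K + k)`!%:R :> R).
    by rewrite -!natrM -(bin_fact (leq_addl K k)) addnK.
  move=> <-; field.
  by rewrite !pnatr_eq0 -!lt0n !fact_gt0 bin_gt0 leq_addl.
rewrite {1}/phi; under eq_bigr => K _.
  rewrite fdiff_s mulr_sumr mulr_suml.
  under eq_bigr do rewrite mulr_sumr mulr_suml.
  over.
rewrite exchange_big/= [RHS]exchange_big/=; apply: eq_bigr => k _.
rewrite exchange_big/=; apply: eq_bigr => i _.
rewrite [RHS](_ : _ = 'C(n, i)%:R * c m k (n - i)%N * (phi i * x ^+ k * (k`!%:R)^-1)).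
  rewrite -shift ?leq_ord// mulr_sumr; apply: eq_bigr => K _.
  by ring.
by ring.
Qed.

End BinomialTransform.

(** * Truncated exponential generating functions *)

Section PolyProducts.
Context {A : comNzRingType}.

Lemma coef_prod_congr (I : Type) (s : seq I) (F G : I -> {poly A}) N :
  (forall p i, (i < N)%N -> (F p)`_i = (G p)`_i) ->
  forall i, (i < N)%N -> (\prod_(p <- s) F p)`_i = (\prod_(p <- s) G p)`_i.
Proof.
move=> FG; elim/big_rec2: _ => // p f g _ fg i iN.
rewrite !coefM; apply: eq_bigr => j _.
by rewrite FG ?fg// (leq_ltn_trans _ iN)// ?leq_subr// -ltnS.
Qed.

Lemma coef_prod_poly k N (a : 'I_k -> nat -> A) j :
  (\prod_(p < k) \poly_(l < N) a p l)`_j =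
  \sum_(l : {ffun 'I_k -> 'I_N} | (\sum_(p < k) (l p : nat) == j)%N)
     \prod_(p < k) a p (l p).
Proof.
under eq_bigr do rewrite poly_def.
rewrite bigA_distr_bigA/= coef_sum [RHS]big_mkcond/=; apply: eq_bigr => l _.
under eq_bigr do rewrite -mul_polyC.
rewrite big_split/= -rmorph_prod/= prodrXr coefCM coefXn eq_sym.
by case: eqP; rewrite ?mulr1 ?mulr0.
Qed.

(** Exponents with sum [j] are at most [j], so their range can be ['I_j.+1], as in the theorem,
    whatever the truncation [N]. *)
Lemma coef_prod_poly_widen k N (a : 'I_k -> nat -> A) j : (j < N)%N ->
  (\prod_(p < k) \poly_(l < N) a p l)`_j =
  \sum_(l : {ffun 'I_k -> 'I_j.+1} | (\sum_(p < k) (l p : nat) == j)%N)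
     \prod_(p < k) a p (l p).
Proof.
move=> jN; rewrite -coef_prod_poly; apply: (@coef_prod_congr _ _ _ _ j.+1) => // p i ij.
by rewrite !coef_poly ij (leq_ltn_trans _ jN).
Qed.

(** Here [p] is a polynomial in the outer variable and [q] one in the inner variable. *)
Lemma coef_lift_mul (p q : {poly A}) i j :
  (map_poly polyC p * q%:P)`_i`_j = p`_i * q`_j.
Proof. by rewrite coefMC coef_map/= coefCM. Qed.

End PolyProducts.

Section Egf.
Context {R : numFieldType} (N : nat).
Implicit Types (a : nat -> R).

Definition egf a : {poly R} := \poly_(b < N) (a b / b`!%:R).

(** Separates the values [a b] from fixed monomials, the shape required by [Ex_lin_prod]; [egf2E]
    does the same in two variables. *)
Lemma egfE a : egf a = \sum_(b < N) (a b)%:P * ((b`!%:R^-1)%:P * 'X^b).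
Proof.
by rewrite /egf poly_def; apply: eq_bigr => b _; rewrite -mul_polyC rmorphM mulrA.
Qed.

(* The truncation of [A(u + t)], with [A] the exponential generating function
   of [a]; [u] is the outer variable and [t] the inner one. *)
Definition egf2 a : {poly {poly R}} :=
  \poly_(l < N) ((l`!%:R)^-1 *: egf (fun b => a (b + l)%N)).

Definition monom2 (i : 'I_N * 'I_N) : {poly {poly R}} :=
  ((i.1`!%:R)^-1 * (i.2`!%:R)^-1)%:P%:P * (('X^(i.2))%:P * 'X^(i.1)).

Lemma egf2E a : egf2 a = \sum_(i : 'I_N * 'I_N) (a (i.2 + i.1)%N)%:P%:P * monom2 i.
Proof.
rewrite /egf2 poly_def
  -(pair_bigA _ (fun l b : 'I_N => (a (b + l)%N)%:P%:P * monom2 (l, b)))/=.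
apply: eq_bigr => l _; rewrite /egf poly_def scaler_sumr -mul_polyC rmorph_sum/= mulr_suml.
apply: eq_bigr => b _; rewrite /monom2/= -!mul_polyC !rmorphM/=.
by ring.
Qed.

(** This is [e^(y(u + t)) = e^(yu) e^(yt)]. It is exact after truncation because [egf2] bounds the
    degrees in [u] and [t] separately. *)
Lemma egf2_pow (y : R) :
  egf2 (fun b => y ^+ b) =
  map_poly polyC (egf (fun b => y ^+ b)) * (egf (fun b => y ^+ b))%:P.
Proof.
apply/polyP => l; apply/polyP => b; rewrite coef_lift_mul !coef_poly.
case: (l < N)%N; last by rewrite coef0 mul0r.
rewrite coefZ !coef_poly; case: (b < N)%N; last by rewrite !mulr0.
by rewrite exprD; ring.
Qed.

(** Agreement with [e^(zt)] modulo [t^N]: a product of truncated exponentials is the exponential of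
    the sum only below degree [N]. *)
Definition exp_coefs (z : R) (p : {poly R}) :=
  forall q, (q < N)%N -> p`_q = z ^+ q / q`!%:R.

Lemma exp_coefs_egf z : exp_coefs z (egf (fun b => z ^+ b)).
Proof. by move=> q qN; rewrite coef_poly qN. Qed.

Lemma exp_coefs1 : exp_coefs 0 1.
Proof.
by move=> q _; rewrite coef1 expr0n; case: q => [|q]; rewrite ?mul0r// fact0 divr1.
Qed.

Lemma exp_coefsM z z' p p' :
  exp_coefs z p -> exp_coefs z' p' -> exp_coefs (z + z') (p * p').
Proof.
move=> zp zp' q qN; rewrite coefMr exprDn mulr_suml; apply: eq_bigr => -[i]/=.
rewrite ltnS => iq _; rewrite zp ?zp' ?(leq_ltn_trans _ qN)// ?leq_subr//.
rewrite -(bin_fact iq) -mulr_natr !natrM; field.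
by rewrite !pnatr_eq0 -!lt0n !fact_gt0 bin_gt0.
Qed.

Lemma exp_coefs_prod k (y : 'I_k -> R) :
  exp_coefs (\sum_(p < k) y p) (\prod_(p < k) egf (fun b => y p ^+ b)).
Proof.
elim/big_rec2: _ => [|p f z _ zf]; first exact: exp_coefs1.
exact: exp_coefsM (exp_coefs_egf _) zf.
Qed.

(* The truncation of [A(u + t) - A(t)]. *)
Definition egf2_pos (a : nat -> R) : {poly {poly R}} :=
  \poly_(l < N) (((0 < l)%N%:R / l`!%:R) *: egf (fun b => a (b + l)%N)).

(** The coefficient of [u^0] in [A(u + t)] is [A(t)]; [N > 0] keeps it in the truncation. *)
Lemma egf2_split a : (0 < N)%N -> egf2 a = (egf a)%:P + egf2_pos a.
Proof.
move=> N0; apply/polyP => l; rewrite coefD coefC !coef_poly.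
case: l => [|l]/=.
  rewrite N0 mul0r scale0r addr0 fact0 invr1 scale1r; congr (\poly_(b < N) (_ / _)).
  by apply/funext => b; rewrite addn0.
by rewrite add0r div1r; case: ifP.
Qed.

(** Expanding the [k] factors gives all tuples of sum [j]; the factor [(0 < l)%N%:R] removes those
    with a zero entry, whence the positivity condition of the theorem. *)
Lemma coef_egf2_pos_exp a k j : (j < N)%N ->
  (egf2_pos a ^+ k)`_j =
  \sum_(l : {ffun 'I_k -> 'I_j.+1} |
          [forall p, (0 < l p)%N] && (\sum_(p < k) (l p : nat) == j)%N)
     ((\prod_(p < k) (l p)`!)%:R)^-1 *:
       \prod_(p < k) egf (fun b => a (b + l p)%N).
Proof.
move=> jN; rewrite -[k in LHS]card_ord -prodr_const coef_prod_poly_widen//.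
rewrite [LHS]big_mkcond [RHS]big_mkcond/=; apply: eq_bigr => l _.
rewrite andbC; case: ifP => //= _; rewrite scaler_prod.
case: ifPn => [/forallP l0|/forallPn[p l0]].
  congr (_ *: _); rewrite natr_prod -prodfV; apply: eq_bigr => p _.
  by rewrite l0 div1r.
by rewrite (bigD1 p)//= (negbTE l0) !mul0r scale0r.
Qed.

End Egf.

(** * Expectations under independence *)

Section Measure.
Context {d : measure_display} {T : measurableType d} {R : realType}.
Variable P : probability T R.
Local Open Scope ereal_scope.
Import HBNNSimple.

(** A simple function is a finite combination of indicators of its level sets, for which the
    identity is the hypothesis. *)
Lemma ge0_integral_weight_nnsfun (g : T -> R) (X : T -> R) (c : R)
    (h : {nnsfun R >-> R}) :
  measurable_fun setT g -> (forall w, 0 <= g w)%R ->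
  measurable_fun setT X -> (0 <= c)%R ->
  (forall B, measurable B ->
    \int[P]_w (g w * \1_B (X w))%:E = c%:E * P (X @^-1` B)) ->
  \int[P]_w (g w * h (X w))%:E = c%:E * \int[P]_w (h (X w))%:E.
Proof.
move=> mg g0 mX c0 gX.
have mB r : measurable (h @^-1` [set r]) by exact: measurable_funPTI.
have mI r : measurable_fun setT (fun w => \1_(h @^-1` [set r]) (X w) : R).
  exact: measurableT_comp.
have gE w : (g w * h (X w))%:E =
    \sum_(r \in range h) (r * (g w * \1_(h @^-1` [set r]) (X w)))%:E.
  rewrite fsumEFin// {1}fimfunE mulr_fsumr; congr EFin.
  by apply: eq_fsbigr => r _; rewrite mulrCA.
have hE w : (h (X w))%:E =
    \sum_(r \in range h) (r * \1_(h @^-1` [set r]) (X w))%:E.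
  by rewrite {1}fimfunE fsumEFin.
have r_ge0 r w : (0 <= r * \1_(h @^-1` [set r]) (X w))%R.
  by rewrite -lee_fin nnfun_muleindic_ge0.
under eq_integral do rewrite gE.
under [in RHS]eq_integral do rewrite hE.
rewrite ge0_integral_fsum//; last 2 first.
- by move=> r; apply/measurable_EFinP; do 2! apply: measurable_funM => //.
- by move=> r w _; rewrite lee_fin mulrCA mulr_ge0.
rewrite ge0_integral_fsum//; last 2 first.
- by move=> r; apply/measurable_EFinP; apply: measurable_funM.
- by move=> r w _; rewrite lee_fin.
rewrite ge0_mule_fsumr; last by move=> r; apply: integral_ge0 => w _; rewrite lee_fin.
apply: eq_fsbigr => r; rewrite inE/= => -[y _ yr].
have r0 : (0 <= r)%R by rewrite -yr.
under eq_integral do rewrite EFinM.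
rewrite ge0_integralZl//; last 2 first.
- by apply/measurable_EFinP; exact: measurable_funM.
- by move=> w _; rewrite lee_fin mulr_ge0.
rewrite gX//.
under [in RHS]eq_integral do rewrite EFinM.
rewrite ge0_integralZl//; last first.
- exact/measurable_EFinP.
rewrite muleCA; congr (_ * (_ * _)).
rewrite -[X in P X]setIT -integral_indic//.
by rewrite -[_ @^-1` _]setTI; exact: mX.
Qed.

(** Monotone convergence along simple functions increasing to [h]. In the application [g] is the
    product of the other factors and [c] its expectation. *)
Lemma ge0_integral_weight (g : T -> R) (X : T -> R) (c : R) (h : R -> R) :
  measurable_fun setT g -> (forall w, 0 <= g w)%R ->
  measurable_fun setT X -> (0 <= c)%R ->
  (forall B, measurable B ->
    \int[P]_w (g w * \1_B (X w))%:E = c%:E * P (X @^-1` B)) ->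
  measurable_fun setT h -> (forall y, 0 <= h y)%R ->
  \int[P]_w (g w * h (X w))%:E = c%:E * \int[P]_w (h (X w))%:E.
Proof.
move=> mg g0 mX c0 gX mh h0.
have mEh : measurable_fun setT (EFin \o h) by exact/measurable_EFinP.
pose h_ := nnsfun_approx measurableT mEh.
have h_cvg y : EFin (h_ n y) @[n --> \oo] --> (h y)%:E.
  by apply: (@cvg_nnsfun_approx _ _ _ setT measurableT (EFin \o h)) => // z _;
    rewrite lee_fin.
have h_nd m n y : (m <= n)%N -> (h_ m y <= h_ n y)%R.
  by move=> mn; exact/lefP/nd_nnsfun_approx.
have mhX n : measurable_fun setT (fun w => h_ n (X w)) by exact: measurableT_comp.
transitivity (limn (fun n => \int[P]_w (g w * h_ n (X w))%:E)).
  rewrite -monotone_convergence//.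
  - apply: eq_integral => w _; apply/esym/cvg_lim => //.
    exact: (cvgeZl (isT : (g w)%:E \is a fin_num) (h_cvg (X w))).
  - by move=> n; apply/measurable_EFinP; exact: measurable_funM.
  - by move=> n w _; rewrite lee_fin mulr_ge0.
  - by move=> w _ m n mn; rewrite lee_fin ler_wpM2l// h_nd.
transitivity (c%:E * limn (fun n => \int[P]_w (h_ n (X w))%:E)).
  rewrite -limeMl//.
    by congr (limn _); apply/funext => n; exact: ge0_integral_weight_nnsfun.
  apply/ereal_nondecreasing_is_cvgn => m n mn; apply: ge0_le_integral => //.
  - by move=> w _; rewrite lee_fin.
  - exact/measurable_EFinP.
  - exact/measurable_EFinP.
  - by move=> w _; rewrite lee_fin h_nd.
congr (_ * _); rewrite -monotone_convergence//.
- by apply: eq_integral => w _; apply/cvg_lim => //; exact: h_cvg.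
- by move=> n; exact/measurable_EFinP.
- by move=> n w _; rewrite lee_fin.
- by move=> w _ m n mn; rewrite lee_fin h_nd.
Qed.

(** The product of the indicators is the indicator of the intersection that appears in the
    definition of independence. *)
Lemma mutually_independent_prod_indic (X : nat -> T -> R) (B : nat -> set R) (s : seq nat) :
  (forall j, measurable_fun setT (X j)) -> mutually_independent P X ->
  uniq s -> (forall j, measurable (B j)) ->
  \int[P]_w (\prod_(j <- s) \1_(B j) (X j w))%:E =
  \prod_(j <- s) P (X j @^-1` B j).
Proof.
move=> mX indX us mB; rewrite -indX//.
have mXB j : measurable (X j @^-1` B j) by rewrite -[_ @^-1` _]setTI; exact: mX.
rewrite -[X in P X]setIT -integral_indic//; last exact: fin_bigcap_measurable.
apply: eq_integral => w _; congr EFin.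
under eq_bigr do rewrite indicE.
rewrite indicE; have [ws|ws] := boolP (w \in _).
  rewrite big_seq big1// => j js; move: ws; rewrite inE => /(_ _ js)/= ?.
  by rewrite mem_set.
apply/eqP; rewrite prodf_seq_eq0; apply: contraNT ws => /hasPn/= ws.
rewrite inE => j /= js; move: (ws _ js); rewrite pnatr_eq0 eqb0 negbK.
by rewrite inE.
Qed.

(* The factors [f j] are traded one at a time for indicators [\1_(B j)]. *)
Lemma mutually_independent_ge0_prod_aux (X : nat -> T -> R) (f : nat -> R -> R)
    (B : nat -> set R) (s K : seq nat) :
  (forall j, measurable_fun setT (X j)) -> mutually_independent P X ->
  (forall j, measurable_fun setT (f j)) -> (forall j y, 0 <= f j y)%R ->
  (forall j, j \in s -> \int[P]_w (f j (X j w))%:E \is a fin_num) ->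
  uniq (s ++ K) -> (forall j, measurable (B j)) ->
  \int[P]_w (\prod_(j <- s) f j (X j w) * \prod_(j <- K) \1_(B j) (X j w))%:E =
  \prod_(j <- s) \int[P]_w (f j (X j w))%:E * \prod_(j <- K) P (X j @^-1` B j).
Proof.
move=> mX indX mf f0; elim: s K B => [|j s IH] K B ff us mB.
  rewrite big_nil mul1e -mutually_independent_prod_indic//.
  by under eq_integral do rewrite big_nil mul1r.
have /IH{IH} IH i : i \in s -> \int[P]_w (f i (X i w))%:E \is a fin_num.
  by move=> si; rewrite ff// inE si orbT.
pose g w := (\prod_(i <- s) f i (X i w) * \prod_(i <- K) \1_(B i) (X i w))%R.
move: us; rewrite /= mem_cat negb_or => /andP[/andP[js jK] us].
have cfin : \prod_(i <- s) \int[P]_w (f i (X i w))%:E *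
            \prod_(i <- K) P (X i @^-1` B i) \is a fin_num.
  rewrite fin_numM//.
    by rewrite big_seq prode_fin_num// => i si; rewrite ff// inE si orbT.
  by rewrite prode_fin_num// => i _; rewrite fin_num_measure// -[_ @^-1` _]setTI; exact: mX.
have c0 : 0 <= \prod_(i <- s) \int[P]_w (f i (X i w))%:E *
            \prod_(i <- K) P (X i @^-1` B i).
  by rewrite mule_ge0// prode_ge0// => i _; apply: integral_ge0 => w _; rewrite lee_fin.
transitivity (\int[P]_w (g w * f j (X j w))%:E).
  by apply: eq_integral => w _; rewrite big_cons -mulrA mulrC.
rewrite (@ge0_integral_weight _ _ (fine (\prod_(i <- s) \int[P]_w (f i (X i w))%:E *
            \prod_(i <- K) P (X i @^-1` B i))))//.
- by rewrite fineK// big_cons muleC muleA.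
- apply: measurable_funM; apply: measurable_prod => i _; exact: measurableT_comp.
- by move=> w; rewrite mulr_ge0// prodr_ge0.
- exact: fine_ge0.
- move=> C mC; rewrite fineK//.
  (* The hypothesis on indicators is the induction hypothesis with [j] moved to [K] and [C] as its
     set; [j] is not in [K], so the other sets are unchanged. *)
  pose B' i := if i == j then C else B i.
  have := IH (j :: K) B'.
  rewrite big_cons /B' eqxx.
  under eq_integral.
    move=> w _; rewrite big_cons eqxx.
    have -> : (\prod_(i <- K) \1_(if i == j then C else B i) (X i w) =
              \prod_(i <- K) \1_(B i) (X i w) :> R)%R.
      by apply: eq_big_seq => i iK; case: eqP => // ij; rewrite -ij iK in jK.
    over.
  have -> : \prod_(i <- K) P (X i @^-1` (if i == j then C else B i)) =
            \prod_(i <- K) P (X i @^-1` B i).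
    by apply: eq_big_seq => i iK; case: eqP => // ij; rewrite -ij iK in jK.
  rewrite [X in _ = X]muleCA [in X in _ = X]muleC => <-.
  + by apply: eq_integral => w _; rewrite /g [in RHS]mulrCA mulrC.
  + by rewrite -cat1s uniq_catCA/= mem_cat negb_or js jK.
  + by move=> i; case: ifP.
Qed.

Lemma integrable_prod_ge0_mutually_independent (X : nat -> T -> R)
    (f : nat -> R -> R) (s : seq nat) :
  (forall j, measurable_fun setT (X j)) -> mutually_independent P X ->
  (forall j, measurable_fun setT (f j)) ->
  (forall j, j \in s -> forall y, 0 <= f j y)%R ->
  (forall j, P.-integrable setT (fun w => (f j (X j w))%:E)) ->
  uniq s ->
  P.-integrable setT (fun w => (\prod_(j <- s) f j (X j w))%:E) /\
  Ex P (fun w => \prod_(j <- s) f j (X j w))%R =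
  (\prod_(j <- s) Ex P (fun w => f j (X j w)))%R.
Proof.
move=> mX indX mf f0 If us.
(* Nonnegativity is known on [s] only, so the functions are replaced by [0] elsewhere. *)
pose g j y : R := if j \in s then f j y else 0%R.
have gf w : (\prod_(j <- s) f j (X j w) = \prod_(j <- s) g j (X j w))%R.
  by apply: eq_big_seq => j js; rewrite /g js.
have If_fin j : \int[P]_w (f j (X j w))%:E \is a fin_num.
  exact: integrable_fin_num.
have prodE : \int[P]_w (\prod_(j <- s) f j (X j w))%:E =
    \prod_(j <- s) \int[P]_w (f j (X j w))%:E.
  have := @mutually_independent_ge0_prod_aux X g (fun=> set0) s [::] mX indX.
  rewrite cats0 big_nil mule1 => H.
  transitivity (\prod_(j <- s) \int[P]_w (g j (X j w))%:E).
    rewrite -H//.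
    - by apply: eq_integral => w _; rewrite gf big_nil mulr1.
    - by move=> j; rewrite /g; case: (j \in s); [exact: mf|exact: measurable_cst].
    - by move=> j y; rewrite /g; case: ifP => // js; exact: f0.
    - by move=> j js; rewrite /g js; exact: If_fin.
  by apply: eq_big_seq => j js; apply: eq_integral => w _; rewrite /g js.
split.
  apply/integrableP; split.
    apply/measurable_EFinP; apply: measurable_prod => i _; exact: measurableT_comp.
  under eq_integral.
    move=> w _; rewrite gee0_abs; last first.
      by rewrite lee_fin big_seq prodr_ge0// => j js; exact: f0.
    over.
  rewrite prodE -ge0_fin_numE ?prode_fin_num// big_seq prode_ge0// => j js.
  by rewrite integral_ge0// => w _; rewrite lee_fin f0.
rewrite /Ex /Rintegral prodE.
by elim: (s) => [|j l IH]; rewrite ?big_nil// !big_cons fineM ?IH// prode_fin_num.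
Qed.

(* The factors [f j] with [j] in [s] are split one at a time into their positive
   and negative parts, whose indices are moved to [K]. *)
Lemma integrable_prod_mutually_independent_aux (X : nat -> T -> R)
    (f : nat -> R -> R) (s K : seq nat) :
  (forall j, measurable_fun setT (X j)) -> mutually_independent P X ->
  (forall j, measurable_fun setT (f j)) ->
  (forall j, j \in K -> forall y, 0 <= f j y)%R ->
  (forall j, P.-integrable setT (fun w => (f j (X j w))%:E)) ->
  uniq (s ++ K) ->
  P.-integrable setT (fun w => (\prod_(j <- s ++ K) f j (X j w))%:E) /\
  Ex P (fun w => \prod_(j <- s ++ K) f j (X j w))%R =
  (\prod_(j <- s ++ K) Ex P (fun w => f j (X j w)))%R.
Proof.
move=> mX indX; elim: s f K => [|j s IH] f K mf f0 If us.
  exact: integrable_prod_ge0_mutually_independent.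
(* Only the factor [j] changes. The induction is over all [f], so it applies to [fp] and to [fn],
   with [j] now among the nonnegative factors. *)
pose fp i := if i == j then (f i)^\+%R else f i.
pose fn i := if i == j then (f i)^\-%R else f i.
have perm_jsK : perm_eq (s ++ j :: K) ((j :: s) ++ K).
  by rewrite perm_catC cat_cons perm_cons perm_catC.
have us' : uniq (s ++ j :: K) by rewrite (perm_uniq perm_jsK).
have jsK i : i \in s ++ K -> i == j = false.
  by move=> isK; apply: contraTF us => /eqP <- /=; rewrite isK.
have [|||//|Ip Ep] := IH fp (j :: K).
- by move=> i; rewrite /fp; case: ifP => // _; exact: measurable_funrpos.
- move=> i; rewrite inE /fp; case: ifP => [_ _ y|_ iK y]; last exact: f0.
  exact: funrpos_ge0.
- move=> i; rewrite /fp; case: ifP => // _.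
  by apply: (@integrable_funrpos _ _ _ _ _ (fun w => f i (X i w))) => //; exact: If.
have [|||//|In En] := IH fn (j :: K).
- by move=> i; rewrite /fn; case: ifP => // _; exact: measurable_funrneg.
- move=> i; rewrite inE /fn; case: ifP => [_ _ y|_ iK y]; last exact: f0.
  exact: funrneg_ge0.
- move=> i; rewrite /fn; case: ifP => // _.
  by apply: (@integrable_funrneg _ _ _ _ _ (fun w => f i (X i w))) => //; exact: If.
have prodB w : (\prod_(i <- (j :: s) ++ K) f i (X i w) =
    \prod_(i <- s ++ j :: K) fp i (X i w) - \prod_(i <- s ++ j :: K) fn i (X i w))%R.
  rewrite !(perm_big _ perm_jsK)/= !big_cons.
  under [in X in (_ = _ * X - _)%R]eq_big_seq => i isK do rewrite /fp jsK//.
  under [in X in (_ = _ - _ * X)%R]eq_big_seq => i isK do rewrite /fn jsK//.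
  by rewrite -mulrBl /fp /fn eqxx -[in LHS](funrposBneg (f j)).
split.
  rewrite (_ : (fun w => _) = (fun w => (\prod_(i <- s ++ j :: K) fp i (X i w))%:E) \-
      (fun w => (\prod_(i <- s ++ j :: K) fn i (X i w))%:E)).
    exact: integrableB.
  by apply/funext => w; rewrite prodB EFinB.
rewrite /Ex; under eq_Rintegral do rewrite prodB.
rewrite RintegralB// -/(Ex P _) -/(Ex P (fun w => _)) Ep En.
rewrite !(perm_big _ perm_jsK)/= !big_cons.
under [in X in (_ * X - _)%R]eq_big_seq => i isK do rewrite /fp jsK//.
under [in X in (_ - _ * X)%R]eq_big_seq => i isK do rewrite /fn jsK//.
rewrite -mulrBl /fp /fn eqxx /Ex -RintegralB//.
- congr (_ * _)%R; apply: eq_Rintegral => w _.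
  by rewrite -[in RHS](funrposBneg (f j)).
- by apply: (@integrable_funrpos _ _ _ _ _ (fun w => f j (X j w))) => //; exact: If.
- by apply: (@integrable_funrneg _ _ _ _ _ (fun w => f j (X j w))) => //; exact: If.
Qed.

Lemma mutually_independent_prod (X : nat -> T -> R) (f : nat -> R -> R) (s : seq nat) :
  (forall j, measurable_fun setT (X j)) -> mutually_independent P X ->
  (forall j, measurable_fun setT (f j)) ->
  (forall j, P.-integrable setT (fun w => (f j (X j w))%:E)) -> uniq s ->
  P.-integrable setT (fun w => (\prod_(j <- s) f j (X j w))%:E) /\
  Ex P (fun w => \prod_(j <- s) f j (X j w))%R =
  (\prod_(j <- s) Ex P (fun w => f j (X j w)))%R.
Proof.
move=> mX indX mf If us; rewrite -[s]cats0.
by apply: integrable_prod_mutually_independent_aux; rewrite ?cats0.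
Qed.

(** * Finiteness of moments and equality in law *)

(** With [t = r0 / 2], the bound [|y|^n <= n! / t^n * e^(t|y|) <= n! / t^n * (e^(ty) + e^(-ty))]
    dominates the power by an integrable function. *)
Lemma integrable_pow_mgf (Y : T -> R) (r0 : R) (n : nat) :
  measurable_fun setT Y -> (0 < r0)%R -> mgf_exists_near0 P Y r0 ->
  P.-integrable setT (fun w => (Y w ^+ n)%:E).
Proof.
move=> mY r0_gt0 mgfY.
pose t : R := (r0 / 2)%R.
have t_gt0 : (0 < t)%R by rewrite divr_gt0.
have t_lt : (t < r0)%R by rewrite ltr_pdivrMr// ltr_pMr// ltr1n.
have I1 := mgfY t; have I2 := mgfY (- t)%R.
rewrite normrN gtr0_norm// in I1 I2.
move: (I1 t_lt) (I2 t_lt) => {}I1 {}I2.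
have I3 := integrableZl measurableT (n`!%:R / t ^+ n)%R (integrableD measurableT I1 I2).
apply: (le_integrable _ _ _ I3) => //.
  by apply/measurable_EFinP; exact: measurable_funX.
move=> w _ /=; rewrite lee_fin normrX.
have expn (k : nat) (x : R) : (0 <= x -> x ^+ k <= k`!%:R * expR x)%R.
  case: k => [|k] x0.
    by rewrite expr0 fact0 mul1r (le_trans _ (expR_ge1Dx x))// lerDl.
  rewrite -ler_pdivrMl ?ltr0n ?fact_gt0// mulrC.
  by apply: le_trans (expR_ge1Dxn k x0); rewrite lerDr.
have t_ge0 := ltW t_gt0.
have c_ge0 : (0 <= n`!%:R / t ^+ n)%R by rewrite divr_ge0// exprn_ge0.
rewrite [leRHS]ger0_norm; last by apply: mulr_ge0 => //; apply: addr_ge0; exact: expR_ge0.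
rewrite mulrAC ler_pdivlMr ?exprn_gt0// -exprMn.
apply: le_trans (expn _ _ _) _; first by rewrite mulr_ge0.
rewrite ler_wpM2l//.
have [y0|y0] := lerP 0 (Y w).
  by rewrite ger0_norm// mulrC lerDl expR_ge0.
by rewrite ltr0_norm// mulNr mulrC -mulNr lerDr expR_ge0.
Qed.

(** Both sides are integrals of [f] against the image measures, which agree on measurable sets. *)
Lemma same_law_ge0_integral (X Y : T -> R) (f : R -> R) :
  measurable_fun setT X -> measurable_fun setT Y -> same_law P X Y ->
  measurable_fun setT f -> (forall y, 0 <= f y)%R ->
  \int[P]_w (f (X w))%:E = \int[P]_w (f (Y w))%:E.
Proof.
move=> mX mY XY mf f0.
have mEf : measurable_fun setT (EFin \o f) by exact/measurable_EFinP.
have := @ge0_integral_pushforward _ _ _ _ _ _ mX P setT _ measurableT mEf.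
have := @ge0_integral_pushforward _ _ _ _ _ _ mY P setT _ measurableT mEf.
rewrite !preimage_setT /= => <- ; last by move=> y _; rewrite lee_fin.
move=> <- ; last by move=> y _; rewrite lee_fin.
by apply: eq_measure_integral => A mA _; exact: XY.
Qed.

Lemma same_law_integrable (X Y : T -> R) (f : R -> R) :
  measurable_fun setT X -> measurable_fun setT Y -> same_law P X Y ->
  measurable_fun setT f ->
  P.-integrable setT (fun w => (f (Y w))%:E) ->
  P.-integrable setT (fun w => (f (X w))%:E).
Proof.
move=> mX mY XY mf /integrableP[_ IY]; apply/integrableP; split.
  by apply/measurable_EFinP; exact: measurableT_comp.
rewrite (same_law_ge0_integral X Y (fun y => `|f y|%R))//.
exact: measurableT_comp.
Qed.

Lemma same_law_Ex (X Y : T -> R) (f : R -> R) :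
  measurable_fun setT X -> measurable_fun setT Y -> same_law P X Y ->
  measurable_fun setT f ->
  Ex P (fun w => f (X w)) = Ex P (fun w => f (Y w)).
Proof.
move=> mX mY XY mf; rewrite /Ex /Rintegral; congr fine.
rewrite integralE [RHS]integralE.
have pE (Z : T -> R) : (fun w => (f (Z w))%:E)^\+ = (fun w => (f^\+%R (Z w))%:E).
  by apply/funext => w; rewrite funeposE -EFin_max.
have nE (Z : T -> R) : (fun w => (f (Z w))%:E)^\- = (fun w => (f^\-%R (Z w))%:E).
  by apply/funext => w; rewrite funenegE -EFinN -EFin_max.
rewrite !pE !nE; congr (_ - _); apply: same_law_ge0_integral => //.
- exact: measurable_funrpos.
- exact: measurable_funrneg.
Qed.

End Measure.

(** * Moments of the partial sums *)

Section LinProd.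
Context {R A : comNzRingType} (iota : {rmorphism R -> A}) (lam : A -> R).
Hypothesis lam_sum : forall (J : finType) (F : J -> A), lam (\sum_j F j) = \sum_j lam (F j).
Hypothesis lam_iota : forall c x, lam (iota c * x) = c * lam x.

Lemma lin_prod_sum (k : nat) (I : finType) (z : 'I_k -> I -> R) (G : 'I_k -> I -> A) :
  lam (\prod_p \sum_i iota (z p i) * G p i) =
  \sum_(f : {ffun 'I_k -> I}) (\prod_p z p (f p)) * lam (\prod_p G p (f p)).
Proof.
rewrite bigA_distr_bigA/= lam_sum; apply: eq_bigr => f _.
by rewrite big_split/= -rmorph_prod lam_iota.
Qed.

End LinProd.

Section Moments.
Context {d : measure_display} {T : measurableType d} {R : realType}.
Variables (P : probability T R) (Ys : nat -> T -> R) (mu : nat -> R).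
Hypothesis mYs : forall j, measurable_fun setT (Ys j).
Hypothesis indYs : mutually_independent P Ys.
Hypothesis IYs : forall j l, P.-integrable setT (fun w => (Ys j w ^+ l)%:E).
Hypothesis ExYs : forall j l, Ex P (fun w => Ys j w ^+ l) = mu l.

Lemma Ex_lincomb (I : finType) (h : I -> T -> R) (c : I -> R) :
  (forall i, P.-integrable setT (fun w => (h i w)%:E)) ->
  P.-integrable setT (fun w => (\sum_i h i w * c i)%:E) /\
  Ex P (fun w => \sum_i h i w * c i) = \sum_i Ex P (h i) * c i.
Proof.
move=> Ih.
have Ihc i : P.-integrable setT (fun w => (h i w * c i)%:E).
  rewrite (_ : (fun w => _) = (fun w => ((c i)%:E * (h i w)%:E)%E)).
    exact: integrableZl.
  by apply/funext => w; rewrite -EFinM mulrC.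
elim: (index_enum I) => [|i s [IH1 IH2]].
  split.
    by under [X in _.-integrable _ X]funext do rewrite big_nil; exact: integrable0.
  by rewrite /Ex; under eq_Rintegral do rewrite big_nil;
    rewrite big_nil Rintegral_cst// mul0r.
split.
  rewrite (_ : (fun w => _) = (fun w => (h i w * c i)%:E) \+
    (fun w => (\sum_(j <- s) h j w * c j)%:E))%E; first exact: integrableD.
  by apply/funext => w; rewrite big_cons EFinD.
rewrite /Ex; under eq_Rintegral do rewrite big_cons.
rewrite RintegralD//; last exact: Ihc.
rewrite big_cons -IH2; congr (_ + _).
by rewrite RintegralZr//; exact: Ih.
Qed.

Lemma Ex_monomial k (l : 'I_k -> nat) :
  P.-integrable setT (fun w => (\prod_(p < k) Ys p w ^+ l p)%:E) /\
  Ex P (fun w => \prod_(p < k) Ys p w ^+ l p) = \prod_(p < k) mu (l p).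
Proof.
(* The independence lemma takes functions indexed by all naturals, so the exponents are extended by
   [0]. *)
pose l' j := if insub j is Some p then l p else 0%N.
have l'E (p : 'I_k) : l' p = l p by rewrite /l' valK.
have prodE w : \prod_(p < k) Ys p w ^+ l p = \prod_(0 <= j < k) Ys j w ^+ l' j.
  by rewrite big_mkord; under [RHS]eq_bigr do rewrite l'E.
have [|||I E] := mutually_independent_prod P Ys (fun j y => y ^+ l' j)
  (index_iota 0 k) mYs indYs.
- by move=> j; exact: measurable_funX.
- by move=> j; exact: IYs.
- exact: iota_uniq.
under [X in _.-integrable _ X]funext do rewrite prodE.
split=> //; under [X in Ex P X]funext do rewrite prodE.
rewrite E big_mkord; by apply: eq_bigr => p _; rewrite l'E.
Qed.

(* To be used with [A] a polynomial ring and [lam] the extraction of a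
   coefficient. *)
Lemma Ex_lin_prod (A : comNzRingType) (iota : {rmorphism R -> A}) (lam : A -> R)
    (k : nat) (I : finType) (dg : 'I_k -> I -> nat) (G : 'I_k -> I -> A) :
  (forall (J : finType) (F : J -> A), lam (\sum_j F j) = \sum_j lam (F j)) ->
  (forall c x, lam (iota c * x) = c * lam x) ->
  P.-integrable setT
    (fun w => (lam (\prod_(p < k) \sum_i iota (Ys p w ^+ dg p i) * G p i))%:E) /\
  Ex P (fun w => lam (\prod_(p < k) \sum_i iota (Ys p w ^+ dg p i) * G p i)) =
  lam (\prod_(p < k) \sum_i iota (mu (dg p i)) * G p i).
Proof.
(* Expanded over choice functions, both sides are linear combinations with the same coefficients, of
   monomials in the [Ys] on one side and of products of moments on the other. *)
move=> lamS lamI; rewrite (lin_prod_sum iota lam lamS lamI).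
under [X in _.-integrable _ X]funext do rewrite (lin_prod_sum iota lam lamS lamI).
under [X in Ex P X]funext do rewrite (lin_prod_sum iota lam lamS lamI).
have [|I1 ->] := @Ex_lincomb _
  (fun (f : {ffun 'I_k -> I}) w => \prod_(p < k) Ys p w ^+ dg p (f p))
  (fun f => lam (\prod_(p < k) G p (f p))).
  by move=> f; exact: (Ex_monomial k (fun p => dg p (f p))).1.
split=> //; apply: eq_bigr => f _.
by rewrite (Ex_monomial k (fun p => dg p (f p))).2.
Qed.

(** The number [c(m, k, q)], written exactly as the inner sum of the theorem with [q] for
    [n - i]. *)
Definition jump_moment (r : R) m k q : R :=
  \sum_(k <= j < m.+1)
   ('C(m, j)%:R *
    \sum_(l : {ffun 'I_k -> 'I_j.+1} |
            [forall p, (0 < l p)%N] && ((\sum_(p < k) (l p : nat)) == j)%N)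
      (multinom j (fun p => (l p : nat)) * r ^+ (m - j) *
       Ex P (fun w => Ssum Ys k w ^+ q * \prod_(p < k) Ys p w ^+ (l p : nat)))).

Section Truncated.
Variable N : nat.

(** [S_k^q / q!] is the coefficient of [t^q] in the product of the [e^(tY_p)]; multiplying a factor
    by [Y_p^(l_p)] shifts its moments by [l_p]. *)
Lemma Ex_Ssum_monomial k (l : 'I_k -> nat) q : (q < N)%N ->
  P.-integrable setT (fun w => (Ssum Ys k w ^+ q * \prod_(p < k) Ys p w ^+ l p)%:E) /\
  Ex P (fun w => Ssum Ys k w ^+ q * \prod_(p < k) Ys p w ^+ l p) =
  q`!%:R * (\prod_(p < k) egf N (fun b => mu (b + l p)%N))`_q.
Proof.
move=> qN.
have pE w : Ssum Ys k w ^+ q * \prod_(p < k) Ys p w ^+ l p =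
    q`!%:R * (\prod_(p < k) \sum_(b < N)
      (Ys p w ^+ (b + l p))%:P * ((b`!%:R^-1)%:P * 'X^b))`_q.
  transitivity (q`!%:R * (\prod_(p < k)
      ((Ys p w ^+ l p)%:P * egf N (fun b => Ys p w ^+ b)))`_q).
    rewrite big_split/= -rmorph_prod coefCM exp_coefs_prod// mulrCA mulrC; congr (_ * _).
    by rewrite mulrCA divff ?mulr1// pnatr_eq0 -lt0n fact_gt0.
  congr (_ * nth 0 (polyseq _) q); apply: eq_bigr => p _; rewrite egfE mulr_sumr.
  by apply: eq_bigr => b _; rewrite mulrA -rmorphM -exprD addnC.
under [X in _.-integrable _ X]funext do rewrite pE.
under [X in Ex P X]funext do rewrite pE.
rewrite (eq_bigr (fun p =>
  \sum_(b < N) (mu (b + l p)%N)%:P * ((b`!%:R^-1)%:P * 'X^b))); last first.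
  by move=> p _; rewrite egfE.
apply: (Ex_lin_prod _ polyC (fun x : {poly R} => q`!%:R * x`_q) k _
  (fun p (b : 'I_N) => (b + l p)%N)).
  by move=> J F; rewrite coef_sum mulr_sumr.
by move=> c x; rewrite coefCM mulrCA.
Qed.

(** [e^(t(S_j + r))] is [e^(rt)] times the product of the [e^(tY_p)], and the expectation turns each
    of these factors into [M(t)]. *)
Lemma Ex_Ssum_shift (r : R) j n : (n < N)%N ->
  Ex P (fun w => (Ssum Ys j w + r) ^+ n) =
  n`!%:R * (egf N (fun b => r ^+ b) * egf N mu ^+ j)`_n.
Proof.
move=> nN.
have pE w : (Ssum Ys j w + r) ^+ n = n`!%:R * (egf N (fun b => r ^+ b) *
    \prod_(p < j) \sum_(b < N) (Ys p w ^+ b)%:P * ((b`!%:R^-1)%:P * 'X^b))`_n.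
  under eq_bigr do rewrite -egfE.
  rewrite (exp_coefsM _ _ _ _ _ (exp_coefs_egf N r)
    (exp_coefs_prod N j (fun p => Ys p w)))//.
  by rewrite mulrCA divff ?mulr1 1?addrC// pnatr_eq0 -lt0n fact_gt0.
under [X in Ex P X]funext do rewrite pE.
rewrite -[j in RHS]card_ord -prodr_const.
under [in RHS]eq_bigr do rewrite egfE.
apply: (Ex_lin_prod _ polyC
  (fun x : {poly R} => n`!%:R * (egf N (fun b => r ^+ b) * x)`_n) j _
  (fun p (b : 'I_N) => (b : nat)) _ _ _).2.
  by move=> J F; rewrite mulr_sumr coef_sum mulr_sumr.
by move=> c x; rewrite mulrCA coefCM mulrCA.
Qed.

Variable r : R.
Let er := egf N (fun b => r ^+ b).

Lemma Ex_Ssum_shiftD j m n : (m < N)%N -> (n < N)%N ->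
  Ex P (fun w => (Ssum Ys j w + r) ^+ (m + n)) =
  m`!%:R * n`!%:R * (map_poly polyC er * er%:P * egf2 N mu ^+ j)`_m`_n.
Proof.
move=> mN nN.
have pE w : (Ssum Ys j w + r) ^+ (m + n) = m`!%:R * n`!%:R *
    (map_poly polyC er * er%:P * \prod_(p < j) \sum_(i : 'I_N * 'I_N)
       (polyC \o polyC) (Ys p w ^+ (i.2 + i.1)) * monom2 N i)`_m`_n.
  have erS := exp_coefsM N _ _ _ _ (exp_coefs_egf N r)
    (exp_coefs_prod N j (fun p => Ys p w)).
  rewrite -[X in _ * X]/(nth 0 (polyseq _) n).
  (* Each factor is [e^(uY_p) e^(tY_p)], so the coefficient of [u^m t^n] is a product of two
     coefficients in one variable. *)
  rewrite (eq_bigr (fun p : 'I_j => map_poly polyC (egf N (fun b => Ys p w ^+ b)) *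
    (egf N (fun b => Ys p w ^+ b))%:P)); last first.
    by move=> p _; rewrite -egf2_pow egf2E.
  rewrite big_split/= -!rmorph_prod mulrACA -!rmorphM coef_lift_mul !erS//.
  rewrite -[\sum_(p < j) _]/(Ssum Ys j w) exprD (addrC r) /=; field.
  by rewrite !pnatr_eq0 -!lt0n !fact_gt0.
under [X in Ex P X]funext do rewrite pE.
rewrite -[j in RHS]card_ord -prodr_const.
rewrite egf2E.
apply: (Ex_lin_prod _ (polyC \o polyC)
  (fun x : {poly {poly R}} => m`!%:R * n`!%:R * (map_poly polyC er * er%:P * x)`_m`_n) j _
  (fun p (i : 'I_N * 'I_N) => (i.2 + i.1)%N) _ _ _).2.
  by move=> J F; rewrite mulr_sumr !coef_sum mulr_sumr.
by move=> c x; rewrite /= mulrCA !coefCM mulrCA.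
Qed.

(** In the coefficient of [u^m], [e^(ru)] contributes [r^(m - j) / (m - j)!] and [D^k] the tuples of
    sum [j]. The factor [m!] then yields the binomial and multinomial coefficients. *)
Lemma jump_momentE m k q : (m < N)%N -> (q < N)%N ->
  jump_moment r m k q =
  m`!%:R * q`!%:R * (map_poly polyC er * egf2_pos N mu ^+ k)`_m`_q.
Proof.
move=> mN qN; rewrite coefMr coef_sum mulr_sumr /jump_moment big_geq_mkord big_mkcond/=.
apply: eq_bigr => -[j]/=; rewrite ltnS => jm _.
have jN : (j < N)%N by exact: leq_ltn_trans mN.
rewrite coef_map/= coefCM coef_egf2_pos_exp// coef_sum coef_poly.
rewrite (leq_ltn_trans (leq_subr _ _) mN).
(* No [k] positive integers have a sum [j < k], which accounts for the lower bound of the sum over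
   [j]. *)
have [kj|jk] := leqP k j; last first.
  rewrite big_pred0 ?mulr0// => l; apply: contraTF jk => /andP[/forallP l0 /eqP lj].
  rewrite -leqNgt -[leqRHS]lj -[leqLHS]card_ord -sum1_card.
  by apply: leq_sum => p _; exact: l0.
rewrite !mulr_sumr; apply: eq_bigr => l _.
rewrite (Ex_Ssum_monomial k _ q qN).2 coefZ /multinom.
rewrite -(bin_fact jm) !natrM; field.
rewrite !pnatr_eq0 -!lt0n !fact_gt0/=.
by rewrite prodn_gt0// => p; rewrite fact_gt0.
Qed.

End Truncated.

Lemma Ex_Ssum_shift_decomp r m n j :
  Ex P (fun w => (Ssum Ys j w + r) ^+ (m + n)) =
  \sum_(k < m.+1) \sum_(i < n.+1)
    'C(n, i)%:R * jump_moment r m k (n - i) *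
    ('C(j, k)%:R * Ex P (fun w => (Ssum Ys (j - k) w + r) ^+ i)).
Proof.
pose N := (m + n).+1.
have mN : (m < N)%N by rewrite ltnS leq_addr.
have nN : (n < N)%N by rewrite ltnS leq_addl.
pose u k := \sum_(i < n.+1) 'C(n, i)%:R * jump_moment r m k (n - i) *
    ('C(j, k)%:R * Ex P (fun w => (Ssum Ys (j - k) w + r) ^+ i)).
(* The statement sums over [k <= m] and the binomial theorem over [k <= j]. Both sums extend to
   [m + j]: beyond [m], [jump_moment] is an empty sum, and beyond [j], [C(j, k) = 0]. *)
rewrite -[RHS](@big_ord_trunc _ u _ (m + j).+1) ?ltnS ?leq_addr//; last first.
  by move=> k mk; rewrite /u big1// => i _; rewrite /jump_moment big_geq// mulr0 mul0r.
rewrite (@big_ord_trunc _ u j.+1) ?ltnS ?leq_addl//; last first.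
  by move=> k jk; rewrite /u big1// => i _; rewrite (bin_small jk) mul0r mulr0.
rewrite (Ex_Ssum_shiftD N)// egf2_split// exprDn.
rewrite mulr_sumr !coef_sum mulr_sumr; apply: eq_bigr => k _.
rewrite [_ * (_ *+ 'C(j, k))]mulrnAr !coefMn -polyC_exp.
(* The factors are regrouped as [e^(ru) D^k] and [e^(rt) M(t)^(j - k)]. The second is constant in
   [u], so the coefficient of [u^m] is taken in the first alone. *)
rewrite (mulrC _%:P (_ ^+ k)) [_ * (_ * _%:P)]mulrACA -polyCM coefMC coefMr.
rewrite -[_ *+ 'C(j, k)]mulr_natr mulr_suml mulr_sumr /u.
apply: eq_bigr => -[i]/=; rewrite ltnS => in' _.
have iN : (i < N)%N by exact: leq_ltn_trans nN.
have niN : (n - i < N)%N by rewrite (leq_ltn_trans (leq_subr _ _) nN).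
rewrite (Ex_Ssum_shift N)//.
rewrite (jump_momentE N)//.
by rewrite -(bin_fact in') !natrM; ring.
Qed.

End Moments.

Theorem theorem2p6 (d : measure_display) (T : measurableType d) (R : realType)
  (P : probability T R) (Y : T -> R) (Ys : nat -> T -> R) (r0 : R)
  (mY : measurable_fun setT Y) (mYs : forall j, measurable_fun setT (Ys j))
  (r0_gt0 : 0 < r0) (hmgf : mgf_exists_near0 P Y r0)
  (hind : mutually_independent P Ys) (hlaw : forall j, same_law P (Ys j) Y)
  (r : nat) (r_gt0 : (0 < r)%N) (m n : nat) (x : R) :
  rBellY P Ys r (m + n) x =
  \sum_(i < n.+1) \sum_(k < m.+1)
    ('C(n, i)%:R * rBellY P Ys r i x * x ^+ k * (k`!%:R)^-1 *
     \sum_(k <= j < m.+1)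
       ('C(m, j)%:R *
        \sum_(l : {ffun 'I_k -> 'I_j.+1} |
                [forall p, (0 < l p)%N] && ((\sum_(p < k) (l p : nat)) == j)%N)
          (multinom j (fun p => (l p : nat)) * r%:R ^+ (m - j) *
           Ex P (fun w => Ssum Ys k w ^+ (n - i) *
                          \prod_(p < k) Ys p w ^+ (l p : nat))))).
Proof.
have mX l : measurable_fun setT (fun y : R => y ^+ l) by exact: measurable_funX.
have IYs j l : P.-integrable setT (fun w => (Ys j w ^+ l)%:E).
  apply: (same_law_integrable P _ Y (fun y => y ^+ l)) => //.
  exact: integrable_pow_mgf hmgf.
have ExYs j l := same_law_Ex P (Ys j) Y (fun y => y ^+ l) (mYs j) mY (hlaw j) (mX l).
(* Up to unfolding, [rBellY] is [phi] for [s n j] the expectation of [(S_j + r)^n]. *)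
apply: (@bell_addition _ x (fun n j => Ex P (fun w => (Ssum Ys j w + r%:R) ^+ n))
  (jump_moment P Ys r%:R)) => [j|m' n' j].
  under [X in Ex P X]funext do rewrite expr0.
  rewrite /Ex Rintegral_cst// mul1r.
  rewrite -[RHS]/(fine 1%E); congr fine; exact: probability_setT.
exact: (Ex_Ssum_shift_decomp P Ys (fun l => Ex P (fun w => Y w ^+ l))).
Qed.
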